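(* For every $1/10$-structured pair $(G,(A,B,S))$ such that $G$ contains neither a claw nor $C_5$ as an induced subgraph, there exist a subset $\hat S\subseteq S$ with $|\hat S|\geq|S|/5$ and a partition $\hat S=S_1\uplus\cdots\uplus S_\ell$ into nonempty sets such that: (1) every $S_i$ is contained in $N(a)$ for some vertex $a\in A$; (2) every $S_i$ is a module of $G[\hat S]$; (3) the quotient graph of this partition of $G[\hat S]$ is the line graph of a triangle-free graph.
   Context: All graphs are finite and simple. $N(v)$ is the open neighbourhood, $N[v]=N(v)\cup\{v\}$, $N(X)$ the set of vertices outside $X$ with a neighbour in $X$, and $N_S[v]=N[v]\cap S$. An $\varepsilon$-structured pair is $(G,(A,B,S))$ where $A,B,S$ are nonempty and partition $V(G)$, $G[A]$ and $G[B]$ are connected, $N(A)=N(B)=S$, and $|N_S[v]|\leq\varepsilon|S|$ for all $v\in V(G)$. The claw is $K_{1,3}$. A set $M$ is a module of $H$ if $N(x)\setminus M=N(y)\setminus M$ for all $x,y\in M$. For a partition of $V(H)$ into nonempty modules, the quotient graph has the parts as vertices, two parts adjacent iff they are fully adjacent in $H$. The line graph of a graph $F$ has vertex set $E(F)$, two edges adjacent iff they share an endpoint. *)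

(* Defs.v *)
From mathcomp Require Import all_boot all_order all_algebra.
Set Implicit Arguments.
Unset Strict Implicit.
Unset Printing Implicit Defensive.

Import Order.TTheory GRing.Theory Num.Theory.
Local Open Scope ring_scope.

Record sgraph := SGraph {
  vertex :> finType;
  adj : rel vertex;
  adj_sym : symmetric adj;
  adj_irr : irreflexive adj }.

Definition nbh (G : sgraph) (v : G) : {set G} := [set u | adj v u].

Definition cnbh (G : sgraph) (v : G) : {set G} := v |: nbh v.

Definition set_nbh (G : sgraph) (X : {set G}) : {set G} :=
  [set v | (v \notin X) && [exists x in X, adj x v]].

Definition isomorphic (G H : sgraph) : Prop :=
  exists2 f : G -> H, bijective f & forall x y, adj (f x) (f y) = adj x y.

Definition contains_induced (G H : sgraph) : Prop :=
  exists2 f : H -> G, injective f & forall x y, adj (f x) (f y) = adj x y.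

(* The graph without vertices counts as connected here; nonemptiness is
   required separately wherever connectedness is used. *)
Definition connected (G : sgraph) : Prop := forall x y : G, connect (@adj G) x y.

Definition triangle_free (G : sgraph) : Prop :=
  forall x y z : G, ~~ [&& adj x y, adj y z & adj x z].

Section Induced.
Variables (G : sgraph) (A : {set G}).
Definition induced_adj : rel {x : G | x \in A} := fun x y => adj (val x) (val y).
Lemma induced_sym : symmetric induced_adj.
Proof. by move=> x y; apply: adj_sym. Qed.
Lemma induced_irr : irreflexive induced_adj.
Proof. by move=> x; apply: adj_irr. Qed.
Definition induced : sgraph := SGraph induced_sym induced_irr.
End Induced.

(* K_{1,3}, with centre 0 *)
Definition claw_adj : rel 'I_4 := fun x y => (x == ord0) != (y == ord0).
Lemma claw_sym : symmetric claw_adj.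
Proof. by move=> x y; rewrite /claw_adj eq_sym. Qed.
Lemma claw_irr : irreflexive claw_adj.
Proof. by move=> x; rewrite /claw_adj eqxx. Qed.
Definition claw : sgraph := SGraph claw_sym claw_irr.

(* [ordS] is the cyclic successor on 'I_5 *)
Definition C5_adj : rel 'I_5 := fun x y => (y == ordS x) || (x == ordS y).
Lemma C5_sym : symmetric C5_adj.
Proof. by move=> x y; rewrite /C5_adj orbC. Qed.
Lemma C5_irr : irreflexive C5_adj.
Proof. by case=> [] [|[|[|[|[|]]]]]. Qed.
Definition C5 : sgraph := SGraph C5_sym C5_irr.

Definition is_module (H : sgraph) (M : {set H}) : Prop :=
  {in M &, forall x y : H, nbh x :\: M = nbh y :\: M}.

(* Only meaningful when [P] is a partition of V(H) into nonempty modules. *)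
Section Quotient.
Variables (H : sgraph) (P : {set {set H}}).
Definition quotient_adj : rel {X : {set H} | X \in P} :=
  fun X Y => (X != Y) && [forall x in val X, forall y in val Y, adj x y].
Lemma quotient_sym : symmetric quotient_adj.
Proof.
move=> X Y; rewrite /quotient_adj eq_sym; congr (_ && _).
by apply/idP/idP => /'forall_in_forall_inP h; apply/'forall_in_forall_inP
  => x xX y yY; rewrite adj_sym h.
Qed.
Lemma quotient_irr : irreflexive quotient_adj.
Proof. by move=> X; rewrite /quotient_adj eqxx. Qed.
Definition quotient_graph : sgraph := SGraph quotient_sym quotient_irr.
End Quotient.

Definition edges (F : sgraph) : {set {set F}} :=
  [set [set p.1; p.2] | p : F * F & adj p.1 p.2].

Section LineGraph.
Variable F : sgraph.
Definition line_adj : rel {a : {set F} | a \in edges F} :=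
  fun a b => (a != b) && (val a :&: val b != set0).
Lemma line_sym : symmetric line_adj.
Proof. by move=> a b; rewrite /line_adj eq_sym setIC. Qed.
Lemma line_irr : irreflexive line_adj.
Proof. by move=> a; rewrite /line_adj eqxx. Qed.
Definition line_graph : sgraph := SGraph line_sym line_irr.
End LineGraph.

Record structured_pair (R : realFieldType) (eps : R) (G : sgraph)
    (A B S : {set G}) : Prop := StructuredPair {
  sp_nonempty : [/\ A != set0, B != set0 & S != set0];
  sp_disjoint : [/\ [disjoint A & B], [disjoint A & S] & [disjoint B & S]];
  sp_cover : A :|: B :|: S = [set: G];
  sp_connA : connected (induced A);
  sp_connB : connected (induced B);
  sp_nbhA : set_nbh A = S;
  sp_nbhB : set_nbh B = S;
  sp_small : forall v : G, #|cnbh v :&: S|%:R <= eps * #|S|%:R }.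

(* Main.v *)
(** Write A_s, B_s for the neighbourhoods of s in A and in B.  Claw-freeness makes
    them cliques and forces, for adjacent s, t in S, that A_s is contained in A_t
    or B_s in B_t.  So either A_s = A_t, or B_s = B_t, or s and t are strictly
    oppositely nested, say A_t < A_s and B_s < B_t ("s before t").  Split S into
    the vertices with nothing before them, those with nothing after them, and the
    remaining middle vertices; the largest of these three sets has at least |S|/3
    elements.  In each of the first two, distinct s, t are adjacent iff A_s = A_t or
    B_s = B_t, so the classes of (A_s, B_s) are modules and the quotient is the
    line graph of a bipartite graph.  Among the middle vertices adjacency is
    transitive, so singletons are modules and the quotient is a disjoint union
    of cliques, the line graph of a disjoint union of stars. *)
Require Import Defs.
From mathcomp Require Import all_boot all_order all_algebra lra zify.
Import Order.TTheory GRing.Theory Num.Theory.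
Local Open Scope ring_scope.

(** * Traces of neighbourhoods and the two forbidden induced subgraphs *)

Definition nbh_in {G : sgraph} (X : {set G}) (v : G) : {set G} := nbh v :&: X.

Lemma in_nbh_in {G : sgraph} (X : {set G}) (v x : G) :
  (x \in nbh_in X v) = adj v x && (x \in X).
Proof. by rewrite !inE. Qed.

Lemma adj_neq {G : sgraph} {x y : G} : adj x y -> x != y.
Proof. by apply: contraTneq => ->; rewrite adj_irr. Qed.

Lemma claw_free_adj {G : sgraph} {c x y z : G} :
  ~ contains_induced G claw ->
  adj c x -> adj c y -> adj c z -> x != y -> x != z -> y != z ->
  [|| adj x y, adj x z | adj y z].
Proof.
move=> noclaw cx cy cz nxy nxz nyz; apply/negPn/negP.
rewrite !negb_or => /and3P[/negPf xy /negPf xz /negPf yz]; apply: noclaw.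
have [ncx ncy ncz] := And3 (adj_neq cx) (adj_neq cy) (adj_neq cz).
exists (fun i : 'I_4 => nth c [:: c; x; y; z] i).
  suff u : uniq [:: c; x; y; z] by move=> i j /eqP; rewrite nth_uniq // => /eqP/val_inj.
  by rewrite /= !inE !negb_or ncx ncy ncz nxy nxz nyz.
have E := (cx, cy, cz, xy, xz, yz, @adj_irr G).
by move=> [[|[|[|[|i]]]] ?] [[|[|[|[|j]]]] ?] //=; rewrite ?E // adj_sym E.
Qed.

Lemma C5_free_chord {G : sgraph} {a b c d e : G} :
  ~ contains_induced G C5 ->
  adj a b -> adj b c -> adj c d -> adj d e -> adj e a ->
  [|| adj a c, adj b d, adj c e, adj d a | adj e b].
Proof.
move=> noC5 ab bc cd de ea; apply/negPn/negP.
rewrite !negb_or => /and5P[/negPf ac /negPf bd /negPf ce /negPf da /negPf eb].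
apply: noC5.
have E := (ab, bc, cd, de, ea, ac, bd, ce, da, eb, @adj_irr G).
have f_adj (i j : 'I_5) : adj (nth a [:: a; b; c; d; e] i)
    (nth a [:: a; b; c; d; e] j) = C5_adj i j.
  by move: i j => [[|[|[|[|[|i]]]]] ?] [[|[|[|[|[|j]]]]] ?] //=;
    rewrite ?E // adj_sym E.
exists (fun i : 'I_5 => nth a [:: a; b; c; d; e] i); last exact: f_adj.
(* no two vertices of C5 have the same neighbourhood *)
move=> i j fij.
have : [forall k, C5_adj i k == C5_adj j k].
  by apply/forallP => k; rewrite -!f_adj fij.
move/forallP => ij; have := ij (ordS i); have := ij (ord_pred i).
move: i j {fij ij} => [[|[|[|[|[|i]]]]] ?] [[|[|[|[|[|j]]]]] ?] //= _ _;
  exact/val_inj.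
Qed.

(** * Elementary facts about structured pairs *)

Section StructuredPair.
Context {G : sgraph} {A B S : {set G}}.
Hypothesis sp : structured_pair (1 / 10 : rat) A B S.

(** A and B play symmetric roles, so every result stated for the side A transfers to B. *)
Lemma structured_pair_swap : structured_pair (1 / 10 : rat) B A S.
Proof.
case: sp => [[? ? ?] [? ? ?] ? ? ? ? ? ?]; split => //.
  by rewrite disjoint_sym.
by rewrite [B :|: A]setUC.
Qed.

Lemma sep_partner {s} : s \in S -> exists2 a, a \in A & adj s a.
Proof.
rewrite -(sp_nbhA sp) inE => /andP[_ /existsP[a /andP[aA as_]]].
by exists a => //; rewrite adj_sym.
Qed.

Lemma sides_anticomplete {a b} : a \in A -> b \in B -> ~~ adj a b.
Proof.
move=> aA bB; apply/negP => ab.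
have [/disjointFl dAB _ /disjointFr dBS] := sp_disjoint sp.
have : b \in set_nbh A.
  by rewrite inE dAB //=; apply/existsP; exists a; rewrite aA.
by rewrite (sp_nbhA sp) dBS.
Qed.

Lemma sep_side_neq {s a} : s \in S -> a \in A -> s != a.
Proof.
move=> sS aA; have [_ /disjointFl dAS _] := sp_disjoint sp.
by apply: contraTneq aA => <-; rewrite dAS.
Qed.

Lemma sides_neq {a b} : a \in A -> b \in B -> a != b.
Proof.
move=> aA bB; have [/disjointFl dAB _ _] := sp_disjoint sp.
by apply: contraTneq aA => ->; rewrite dAB.
Qed.

End StructuredPair.

(** * Neighbourhoods of separator vertices in one side *)

Section Sides.
Context {G : sgraph} {A B S : {set G}}.
Hypotheses (sp : structured_pair (1 / 10 : rat) A B S)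
  (noclaw : ~ contains_induced G claw).

(** Two nonadjacent members and a neighbour of s in B would be the leaves of a claw centred at s. *)
Lemma nbh_in_clique {s a a'} : s \in S -> a \in nbh_in A s -> a' \in nbh_in A s ->
  a != a' -> adj a a'.
Proof.
rewrite !in_nbh_in => sS /andP[sa aA] /andP[sa' a'A] naa'.
have [b bB sb] := sep_partner (structured_pair_swap sp) sS.
have := claw_free_adj noclaw sa sa' sb naa' (sides_neq sp aA bB) (sides_neq sp a'A bB).
by rewrite (negPf (sides_anticomplete sp aA bB)) (negPf (sides_anticomplete sp a'A bB)) !orbF.
Qed.

(** Otherwise s has a neighbour in A and one in B that both miss t, and these two with t are the
    leaves of a claw centred at s. *)
Lemma nbh_in_sub {s t} : s \in S -> t \in S -> adj s t ->
  (nbh_in A s \subset nbh_in A t) || (nbh_in B s \subset nbh_in B t).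
Proof.
move=> sS tS st; apply/negPn/negP; rewrite negb_or.
case/andP=> /subsetPn[a]; rewrite !in_nbh_in => /andP[sa aA]; rewrite aA andbT => ta.
case/subsetPn=> b; rewrite !in_nbh_in => /andP[sb bB]; rewrite bB andbT => tb.
have := claw_free_adj noclaw sa sb st (sides_neq sp aA bB).
rewrite [a == t]eq_sym [b == t]eq_sym (sep_side_neq sp tS aA).
rewrite (sep_side_neq (structured_pair_swap sp) tS bB) => /(_ isT isT).
by rewrite (negPf (sides_anticomplete sp aA bB)) !(adj_sym _ t) (negPf ta) (negPf tb).
Qed.

(** Here a is the centre of a potential claw with leaves s, t and a'. *)
Lemma nbh_in_conflict {s t a a'} : s \in S -> t \in S -> s != t -> ~~ adj s t ->
  a \in nbh_in A s -> a \in nbh_in A t -> a' \in A -> adj a a' ->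
  (a' \in nbh_in A s) || (a' \in nbh_in A t).
Proof.
rewrite !in_nbh_in => sS tS nst st /andP[sa aA] /andP[ta _] a'A aa'; rewrite a'A !andbT.
rewrite adj_sym in sa; rewrite adj_sym in ta.
have := claw_free_adj noclaw sa ta aa' nst (sep_side_neq sp sS a'A) (sep_side_neq sp tS a'A).
by rewrite (negPf st).
Qed.

(* Otherwise [nbh_in A s] is closed under adjacency in the connected graph G[A],
   so s and t are complete to A, and claw-freeness forces S into the union of
   the closed neighbourhoods of s and t, which is too small. *)
Lemma nbh_in_inj_adj {s t} : s \in S -> t \in S -> s != t ->
  nbh_in A s = nbh_in A t -> adj s t.
Proof.
move=> sS tS nst est; apply/negPn/negP => st.
have [a0 a0A sa0] := sep_partner sp sS.
have clos a a' : a \in nbh_in A s -> a' \in A -> adj a a' -> a' \in nbh_in A s.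
  move=> as_ a'A aa'; have at_ : a \in nbh_in A t by rewrite -est.
  by have := nbh_in_conflict sS tS nst st as_ at_ a'A aa'; rewrite -est orbb.
have full a : a \in A -> a \in nbh_in A s.
  move=> aA.
  have walk (p : seq (induced A)) (x : induced A) :
      val x \in nbh_in A s -> path (@adj _) x p -> val (last x p) \in nbh_in A s.
    elim: p x => //= y p IH x xs /andP[xy]; apply: IH.
    exact: clos xs (valP y) xy.
  have /connectP[p x0p /(congr1 val) /= ->] := sp_connA sp (Sub a0 a0A) (Sub a aA).
  by apply: walk x0p; rewrite in_nbh_in sa0.
have cov : S \subset (cnbh s :&: S) :|: (cnbh t :&: S).
  apply/subsetP => r rS; have [a aA ra] := sep_partner sp rS.
  have as_ := full a aA; have at_ := as_; rewrite est in at_.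
  rewrite !inE rS !andbT.
  case: (eqVneq r s) => //= nrs; case: (eqVneq r t) => //= nrt; first by rewrite orbT.
  move: as_ at_; rewrite !in_nbh_in aA !andbT ![adj _ a]adj_sym => as_ at_.
  rewrite adj_sym in ra; have := claw_free_adj noclaw as_ at_ ra nst.
  by rewrite ![_ == r]eq_sym nrs nrt (negPf st) => /(_ isT isT).
have S_gt0 : (0 < #|S|)%N by have [_ _] := sp_nonempty sp; rewrite card_gt0.
have := leq_trans (subset_leq_card cov) (leq_card_setU _ _).
rewrite -(ler_nat rat) natrD.
have := sp_small sp s; have := sp_small sp t; rewrite -(ltr_nat rat) in S_gt0.
by lra.
Qed.

(** Take a in A_w and a' in A_u' outside A_u. Both lie in the clique A_u', so they are adjacent, and
    a' misses u and w; if u and w were nonadjacent, a would be the centre of a claw with leaves u,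
    w, a'. *)
Lemma adj_of_nbh_in_sub {u w u'} : u \in S -> w \in S -> u != w -> u' \in S ->
  nbh_in A u \proper nbh_in A u' -> nbh_in A w \subset nbh_in A u -> adj u w.
Proof.
move=> uS wS nuw u'S /properP[/subsetP uu' [a' a'u' a'u]] /subsetP wu.
apply/negPn/negP => uw.
have [a aA wa] := sep_partner sp wS.
have aw : a \in nbh_in A w by rewrite in_nbh_in wa.
have au := wu _ aw.
have naa' : a != a' by apply: contraNneq a'u => <-.
have aa' := nbh_in_clique u'S (uu' _ au) a'u' naa'.
have a'A : a' \in A by move: a'u'; rewrite in_nbh_in => /andP[].
have := nbh_in_conflict uS wS nuw uw au aw a'A aa'.
by rewrite (negPf a'u) => /wu; rewrite (negPf a'u).
Qed.

(* A private neighbour of u in A, one of w and a common neighbour in B would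
   form an induced C5 with u and w. *)
Lemma C5_free_disjoint {u w x} : ~ contains_induced G C5 ->
  u \in S -> w \in S -> ~~ adj u w -> x \in S ->
  ~~ (nbh_in A u \subset nbh_in A w) -> ~~ (nbh_in A w \subset nbh_in A u) ->
  nbh_in A u \subset nbh_in A x -> nbh_in A w \subset nbh_in A x ->
  [disjoint nbh_in B u & nbh_in B w].
Proof.
move=> noC5 uS wS uw xS /subsetPn[a au aw] /subsetPn[a' a'w a'u] /subsetP ux /subsetP wx.
apply/pred0P => b /=; apply/negP => /andP[].
rewrite !in_nbh_in => /andP[ub bB] /andP[wb _].
have naa' : a != a' by apply: contraNneq a'u => <-.
have aa' := nbh_in_clique xS (ux _ au) (wx _ a'w) naa'.
move: au aw a'w a'u; rewrite !in_nbh_in => /andP[ua aA]; rewrite aA andbT => wa.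
case/andP=> wa' a'A; rewrite a'A andbT => ua'.
rewrite (adj_sym w) in wa'; rewrite (adj_sym u b) in ub.
have := C5_free_chord noC5 ua aa' wa' wb ub.
rewrite (negPf ua') (adj_sym a w) (negPf wa) (adj_sym w u) (negPf uw).
by rewrite (negPf (sides_anticomplete sp a'A bB)) adj_sym
  (negPf (sides_anticomplete sp aA bB)).
Qed.

Lemma nbh_in_neq0 {s} : s \in S -> nbh_in A s != set0.
Proof.
by move=> /(sep_partner sp)[a aA sa]; apply/set0Pn; exists a; rewrite in_nbh_in sa.
Qed.

End Sides.

(** * Opposite nesting of adjacent separator vertices *)

Definition nested_before {G : sgraph} (A B : {set G}) : rel G :=
  fun s t => [&& adj s t, nbh_in A t \proper nbh_in A s & nbh_in B s \proper nbh_in B t].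

Lemma nested_before_swap {G : sgraph} (A B : {set G}) s t :
  nested_before B A s t = nested_before A B t s.
Proof. by rewrite /nested_before adj_sym [(_ \proper _) && _]andbC. Qed.

Definition nested_middle {G : sgraph} (A B S : {set G}) : {set G} :=
  [set s in S | [exists t in S, nested_before A B t s]
             && [exists t in S, nested_before A B s t]].

Lemma nested_middle_swap {G : sgraph} (A B S : {set G}) :
  nested_middle B A S = nested_middle A B S.
Proof.
apply/setP => s; rewrite !inE; congr (_ && _); rewrite andbC.
by congr (_ && _); apply: eq_existsb => t; rewrite nested_before_swap.
Qed.

(** Apply [nbh_in_sub] to (s, t) and to (t, s): inclusions on the same side combine to an equality,
    and inclusions on different sides give the opposite nestings. *)
Lemma adj_nbh_in_cases {G : sgraph} {A B S : {set G}} {s t} :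
  structured_pair (1 / 10 : rat) A B S -> ~ contains_induced G claw ->
  s \in S -> t \in S -> adj s t ->
  [\/ nbh_in A s = nbh_in A t, nbh_in B s = nbh_in B t,
      nested_before A B s t | nested_before A B t s].
Proof.
move=> sp noclaw sS tS st; have ts : adj t s by rewrite adj_sym.
have := nbh_in_sub sp noclaw sS tS st; have := nbh_in_sub sp noclaw tS sS ts.
rewrite /nested_before !properEneq st ts /= ![_ == nbh_in _ s]eq_sym.
case: eqVneq => [?|_] /=; first by constructor 1.
case: eqVneq => [?|_] /=; first by constructor 2.
case/orP=> [At|Bt] /orP[As|Bs].
- by constructor 1; apply/eqP; rewrite eqEsubset As.
- by constructor 3; rewrite At.
- by constructor 4; rewrite As.
- by constructor 2; apply/eqP; rewrite eqEsubset Bs.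
Qed.

(** * Transitivity of adjacency among the middle vertices *)

Section Middle.
Context {G : sgraph} {A B S : {set G}}.
Hypotheses (sp : structured_pair (1 / 10 : rat) A B S)
  (noclaw : ~ contains_induced G claw) (noC5 : ~ contains_induced G C5).
Let sp' := structured_pair_swap sp.
Local Notation M := (nested_middle A B S).

Lemma nested_middleP {s} : s \in M ->
  [/\ s \in S, exists2 t, t \in S & nested_before A B t s
    & exists2 t, t \in S & nested_before A B s t].
Proof.
rewrite inE => /and3P[sS /existsP[t /andP[tS ts]] /existsP[r /andP[rS sr]]].
by split=> //; [exists t | exists r].
Qed.

(** A vertex before u has a strictly larger trace on A and one after u a strictly larger trace on B,
    as [adj_of_nbh_in_sub] requires on each side. *)
Lemma middle_incomparable {u w} : u \in M -> w \in S -> u != w -> ~~ adj u w ->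
  ~~ (nbh_in A w \subset nbh_in A u) /\ ~~ (nbh_in B w \subset nbh_in B u).
Proof.
move=> /nested_middleP[uS [u' u'S /and3P[_ uu' _]] [u'' u''S /and3P[_ _ uu'']]] wS nuw uw.
split; apply: contraNN uw => sub.
  exact: (adj_of_nbh_in_sub sp noclaw uS wS nuw u'S uu' sub).
exact: (adj_of_nbh_in_sub sp' noclaw uS wS nuw u''S uu'' sub).
Qed.

(* B_u and B_w lie in the clique B_v while A_u and A_w meet in A_v, against
   [C5_free_disjoint]. *)
Lemma middle_fork {u v w} : u \in M -> v \in S -> w \in M -> u != w -> ~~ adj u w ->
  nested_before A B u v -> nested_before A B w v -> False.
Proof.
move=> uM vS wM nuw uw /and3P[_ Avu Buv] /and3P[_ Avw Bwv].
have [[uS _ _] [wS _ _]] := (nested_middleP uM, nested_middleP wM).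
have nwu : w != u by rewrite eq_sym.
have wu : ~~ adj w u by rewrite adj_sym.
have [_ Bwu] := middle_incomparable uM wS nuw uw.
have [_ Buw] := middle_incomparable wM uS nwu wu.
have := C5_free_disjoint sp' noclaw noC5 uS wS uw vS Buw Bwu
  (proper_sub Buv) (proper_sub Bwv).
have [a av] := set0Pn _ (nbh_in_neq0 sp vS).
move/disjointFr/(_ (subsetP (proper_sub Avu) _ av)).
by rewrite (subsetP (proper_sub Avw) _ av).
Qed.

(* If x comes after v, then x is adjacent to u and not to w, A_u and A_w are
   disjoint, and v has a claw with leaves x, w and a vertex of A_v \ A_x. *)
Lemma middle_bridge {u v w} : u \in M -> v \in M -> w \in M -> u != w -> ~~ adj u w ->
  adj v w -> nbh_in A u = nbh_in A v -> nbh_in B w = nbh_in B v -> False.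
Proof.
move=> uM vM wM nuw uw vw Auv Bwv.
have [uS _ _] := nested_middleP uM; have [wS _ _] := nested_middleP wM.
have [vS _ [x xS /and3P[vx Axv Bvx]]] := nested_middleP vM.
have nwu : w != u by rewrite eq_sym.
have wu : ~~ adj w u by rewrite adj_sym.
have [Awu Bwu] := middle_incomparable uM wS nuw uw.
have [Auw Buw] := middle_incomparable wM uS nwu wu.
have nux : u != x by apply: contraTneq Axv => <-; rewrite Auv properxx.
have ux : adj u x.
  have Axu : nbh_in A x \subset nbh_in A u by rewrite Auv proper_sub.
  by apply/negPn/negP => /(middle_incomparable uM xS nux)[]; rewrite Axu.
have Bux : nbh_in B u \subset nbh_in B x.
  have := nbh_in_sub sp noclaw uS xS ux; rewrite Auv.
  by move: Axv; rewrite properE => /andP[_ /negPf->].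
have Bwx : nbh_in B w \subset nbh_in B x by rewrite Bwv proper_sub.
have dA := C5_free_disjoint sp' noclaw noC5 uS wS uw xS Buw Bwu Bux Bwx.
have nwx : w != x by apply: contraTneq Bvx => <-; rewrite Bwv properxx.
have xw : ~~ adj x w.
  apply/negP => xw; case/orP: (nbh_in_sub sp noclaw xS wS xw) => [Axw|].
    have [a ax] := set0Pn _ (nbh_in_neq0 sp xS).
    have au : a \in nbh_in A u by rewrite Auv (subsetP (proper_sub Axv)).
    by have := disjointFr dA au; rewrite (subsetP Axw).
  by rewrite Bwv; move: Bvx; rewrite properE => /andP[_ /negPf->].
have /properP[_ [a av ax]] := Axv.
have au : a \in nbh_in A u by rewrite Auv.
move: (disjointFr dA au) av ax; rewrite !in_nbh_in => aw /andP[va aA].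
rewrite aA !andbT in aw * => xa.
have := claw_free_adj noclaw vx vw va.
rewrite [x == w]eq_sym nwx (sep_side_neq sp xS aA) (sep_side_neq sp wS aA).
by rewrite (negPf xw) (negPf xa) aw => /(_ isT isT isT).
Qed.

End Middle.

(** If u and w are nonadjacent, their traces are incomparable on both sides. Of the sixteen
    combinations of cases for uv and vw, twelve chain to a comparison of these traces; the other
    four are two bridges and two forks. *)
Lemma nested_middle_trans {G : sgraph} {A B S : {set G}} {u v w} :
  structured_pair (1 / 10 : rat) A B S ->
  ~ contains_induced G claw -> ~ contains_induced G C5 ->
  u \in nested_middle A B S -> v \in nested_middle A B S ->
  w \in nested_middle A B S -> adj u v -> adj v w -> u != w -> adj u w.
Proof.
move=> sp noclaw noC5 uM vM wM uv vw nuw; apply/negPn/negP => uw.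
have sp' := structured_pair_swap sp.
have [uS _ _] := nested_middleP uM.
have [vS _ _] := nested_middleP vM.
have [wS _ _] := nested_middleP wM.
have nwu : w != u by rewrite eq_sym.
have wu : ~~ adj w u by rewrite adj_sym.
have vu : adj v u by rewrite adj_sym.
have [/negP Awu /negP Bwu] := middle_incomparable sp noclaw uM wS nuw uw.
have [/negP Auw /negP Buw] := middle_incomparable sp noclaw wM uS nwu wu.
have [Auv|Buv|luv|lvu] := adj_nbh_in_cases sp noclaw uS vS uv;
  have [Avw|Bvw|lvw|lwv] := adj_nbh_in_cases sp noclaw vS wS vw.
- by apply: Auw; rewrite Auv Avw.
- exact: (middle_bridge sp noclaw noC5 uM vM wM nuw uw vw Auv (esym Bvw)).
- by case/and3P: lvw => _ /proper_sub Awv _; apply: Awu; rewrite Auv.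
- by case/and3P: lwv => _ /proper_sub Avw _; apply: Auw; rewrite Auv.
- exact: (middle_bridge sp noclaw noC5 wM vM uM nwu wu vu (esym Avw) Buv).
- by apply: Buw; rewrite Buv Bvw.
- by case/and3P: lvw => _ _ /proper_sub Bvw; apply: Buw; rewrite Buv.
- by case/and3P: lwv => _ _ /proper_sub Bwv; apply: Bwu; rewrite Buv.
- by case/and3P: luv => _ /proper_sub Avu _; apply: Awu; rewrite -Avw.
- by case/and3P: luv => _ _ /proper_sub Buv; apply: Buw; rewrite -Bvw.
- case/and3P: luv => _ /proper_sub Avu _; case/and3P: lvw => _ /proper_sub Awv _.
  by apply: Awu; apply: subset_trans Awv Avu.
- exact: (middle_fork sp noclaw noC5 uM vS wM nuw uw luv lwv).
- by case/and3P: lvu => _ /proper_sub Auv _; apply: Auw; rewrite -Avw.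
- by case/and3P: lvu => _ _ /proper_sub Bvu; apply: Bwu; rewrite -Bvw.
(* Here u and w both come after v; exchanging A and B reverses the order and turns this into
   [middle_fork]. *)
- rewrite -nested_before_swap in lvu; rewrite -nested_before_swap in lvw.
  rewrite -nested_middle_swap in uM; rewrite -nested_middle_swap in wM.
  exact: (middle_fork sp' noclaw noC5 uM vS wM nuw uw lvu lvw).
- case/and3P: lvu => _ /proper_sub Auv _; case/and3P: lwv => _ /proper_sub Avw _.
  by apply: Auw; apply: subset_trans Auv Avw.
Qed.

(** * Line graphs of bipartite graphs from two labellings f and g *)

(** Each u in D becomes an edge between [f u] and [g u]; the disjoint sum keeps the two sides apart
    even where values of f and g coincide. *)
Definition bipartite_adj (T V : finType) (D : {set T}) (f g : T -> V) : rel (V + V) :=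
  fun p q => match p, q with
  | inl X, inr Y | inr Y, inl X => [exists u in D, (f u == X) && (g u == Y)]
  | _, _ => false
  end.

Lemma bipartite_sym (T V : finType) (D : {set T}) (f g : T -> V) : symmetric (bipartite_adj T V D f g).
Proof. by move=> [?|?] [?|?]. Qed.

Lemma bipartite_irr (T V : finType) (D : {set T}) (f g : T -> V) : irreflexive (bipartite_adj T V D f g).
Proof. by move=> [?|?]. Qed.

Definition bipartite_graph (T V : finType) (D : {set T}) (f g : T -> V) : sgraph :=
  SGraph (bipartite_sym T V D f g) (bipartite_irr T V D f g).

Section TwoKernels.
Context {G : sgraph} {V : finType} {T : {set G}} {f g : G -> V}.
Hypothesis adjT : {in T &, forall x y, x != y -> adj x y = (f x == f y) || (g x == g y)}.
Local Notation H := (induced T).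
Local Notation F := (bipartite_graph G V T f g).

Let key (x : H) := (f (val x), g (val x)).
Definition kernel_partition : {set {set H}} := preim_partition key [set: H].
Local Notation P := kernel_partition.
Let cls (x : H) : {set H} := [set y | key x == key y].

Lemma kernel_partition_cls (x : H) : cls x \in P.
Proof.
by apply/imsetP; exists x; rewrite ?inE //; apply/setP => y; rewrite !inE.
Qed.

(** The boolean equality, here and in [edge_ends], lets [sigW] choose representatives in
    [kernel_quotient]. *)
Lemma kernel_partitionP (X : {set H}) : X \in P -> exists x, X == cls x.
Proof.
by case/imsetP => x _ ->; exists x; apply/eqP/setP => y; rewrite !inE.
Qed.

Lemma cls_eq (x y : H) : (cls x == cls y) = (key x == key y).
Proof.
apply/eqP/eqP => [/setP/(_ y)|e]; first by rewrite !inE eqxx => /eqP.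
by apply/setP => z; rewrite !inE e.
Qed.

Lemma adj_key (x y : H) : x != y ->
  adj x y = (f (val x) == f (val y)) || (g (val x) == g (val y)).
Proof. by move=> nxy; apply: adjT (valP x) (valP y) _; rewrite (inj_eq val_inj). Qed.

(** Adjacency of distinct vertices depends only on their keys, and a vertex outside the class
    differs from all members of it. *)
Lemma kernel_partition_module X : X \in P -> is_module X.
Proof.
case/kernel_partitionP => x /eqP-> y z; rewrite !inE => /eqP kxy /eqP kxz.
apply/setP => t; rewrite !inE; case: (boolP (key x == key t)) => // kxt.
congr (_ && _).
have nyt : y != t by apply: contraNneq kxt => <-; rewrite kxy.
have nzt : z != t by apply: contraNneq kxt => <-; rewrite kxz.
by rewrite !adj_key //; move: kxz; rewrite kxy => [[-> ->]].
Qed.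

Let ends (x : H) : {set F} := [set inl (f (val x)); inr (g (val x))].

Lemma ends_edge x : ends x \in edges F.
Proof.
apply/imsetP; exists (inl (f (val x)) : F, inr (g (val x)) : F) => //.
by rewrite inE /=; apply/existsP; exists (val x); rewrite (valP x) !eqxx.
Qed.

Lemma edge_ends e : e \in edges F -> exists x, e == ends x.
Proof.
case/imsetP => [[p q]]; rewrite inE /= => pq ->.
case: p q pq => [X|X] [Y|Y] //= /existsP[u /and3P[uT /eqP fu /eqP gu]];
  exists (Sub u uT : H); apply/eqP; rewrite /ends /= fu gu //.
exact: setUC.
Qed.

Lemma ends_eq x y : (ends x == ends y) = (key x == key y).
Proof.
apply/eqP/eqP => [/setP e|[]]; last by rewrite /ends => -> ->.
have := e (inl (f (val x))); have := e (inr (g (val x))).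
rewrite !inE !eqxx !orbT /= => /esym/eqP[gxy] /esym.
by rewrite orbF => /eqP[fxy]; rewrite /key fxy gxy.
Qed.

Lemma ends_meet x y : (ends x :&: ends y != set0) =
  (f (val x) == f (val y)) || (g (val x) == g (val y)).
Proof.
apply/set0Pn/orP => [[[X|X]]|].
- by rewrite !inE !orbF => /andP[/eqP[->] /eqP[->]]; left.
- by rewrite !inE => /andP[/eqP[->] /eqP[->]]; right.
by case=> /eqP e; [exists (inl (f (val x))) | exists (inr (g (val x)))];
  rewrite !inE e !eqxx ?orbT.
Qed.

Lemma bipartite_triangle_free : triangle_free F.
Proof. by move=> [?|?] [?|?] [?|?]; rewrite /= ?andbF. Qed.

(** The class of x goes to the edge [ends x]. Both are determined exactly by the key of x, which
    gives the bijection; distinct classes are fully adjacent iff their keys agree in a coordinate,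
    that is, iff the edges meet. *)
Lemma kernel_quotient : isomorphic (quotient_graph P) (line_graph F).
Proof.
pose rep (X : quotient_graph P) := sigW (kernel_partitionP _ (valP X)).
pose erep (e : line_graph F) := sigW (edge_ends _ (valP e)).
pose h (X : quotient_graph P) : line_graph F := exist (fun e => e \in edges F) _ (ends_edge (sval (rep X))).
pose k (e : line_graph F) : quotient_graph P :=
  exist (fun X => X \in P) _ (kernel_partition_cls (sval (erep e))).
exists h.
  exists k => [X|e]; apply/val_inj => /=.
    rewrite [RHS](eqP (svalP (rep X))); apply/eqP; rewrite cls_eq -ends_eq.
    by rewrite -(eqP (svalP (erep (h X)))).
  rewrite [RHS](eqP (svalP (erep e))); apply/eqP; rewrite ends_eq -cls_eq.
  by rewrite -(eqP (svalP (rep (k e)))).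
move=> X Y; set x := sval (rep X); set y := sval (rep Y).
have Xx : val X = cls x := eqP (svalP (rep X)).
have Yy : val Y = cls y := eqP (svalP (rep Y)).
have -> : adj (h X) (h Y) = (ends x != ends y) && (ends x :&: ends y != set0) by [].
have -> : adj X Y =
  (val X != val Y) && [forall x' in val X, forall y' in val Y, adj x' y'] by [].
clearbody x y; rewrite Xx Yy ends_eq ends_meet.
rewrite cls_eq; case: (boolP (key x == key y)) => //= kxy.
have nkey x' y' : x' \in cls x -> y' \in cls y -> adj x' y' =
    (f (val x) == f (val y)) || (g (val x) == g (val y)).
  rewrite !inE => /eqP ex /eqP ey.
  have nxy : x' != y' by apply: contraNneq kxy => e; rewrite ex ey e.
  by rewrite adj_key //; case: ex => -> ->; case: ey => -> ->.
apply/idP/'forall_in_forall_inP => [e x' xx' y' yy'|all_adj].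
  by have /= -> := nkey x' y' xx' yy'.
have [xx yy] : x \in cls x /\ y \in cls y by rewrite !inE !eqxx.
by rewrite -(nkey x y xx yy); apply: all_adj.
Qed.

Lemma kernel_decomposition (A : {set G}) :
  (forall x, x \in T -> exists2 a, a \in A &
     forall y, y \in T -> f y = f x -> g y = g x -> adj a y) ->
  exists P : {set {set induced T}},
    [/\ partition P [set: induced T],
        forall X, X \in P -> exists2 a, a \in A & val @: X \subset nbh a,
        forall X, X \in P -> is_module X
      & exists2 F : sgraph, triangle_free F &
          isomorphic (quotient_graph P) (line_graph F)].
Proof.
move=> common; exists P; split.
- exact: preim_partitionP.
- move=> X /kernel_partitionP[x /eqP->]; have [a aA ax] := common _ (valP x).
  exists a => //; apply/subsetP => _ /imsetP[y + ->]; rewrite !inE => /eqP[fxy gxy].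
  exact: ax (valP y) (esym fxy) (esym gxy).
- exact: kernel_partition_module.
- by exists F; [exact: bipartite_triangle_free | exact: kernel_quotient].
Qed.

End TwoKernels.

(** * Choosing the large subset of the separator *)

Definition antichain {G : sgraph} (A B T : {set G}) : Prop :=
  {in T &, forall s t, ~~ nested_before A B s t}.

(** Without nested pairs only the two equalities of [adj_nbh_in_cases] remain; the converse is
    [nbh_in_inj_adj] on either side. *)
Lemma antichain_adj {G : sgraph} {A B S T : {set G}} :
  structured_pair (1 / 10 : rat) A B S -> ~ contains_induced G claw ->
  T \subset S -> antichain A B T ->
  {in T &, forall s t, s != t -> adj s t =
     (nbh_in A s == nbh_in A t) || (nbh_in B s == nbh_in B t)}.
Proof.
move=> sp noclaw /subsetP TS anti s t sT tT nst.
have [sS tS] := (TS _ sT, TS _ tT).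
apply/idP/orP => [st|[]/eqP].
- case: (adj_nbh_in_cases sp noclaw sS tS st) => [->|->|l|l]; [by left|by right|..].
    by have := anti _ _ sT tT; rewrite l.
  by have := anti _ _ tT sT; rewrite l.
- exact: (nbh_in_inj_adj sp noclaw).
- exact: (nbh_in_inj_adj (structured_pair_swap sp) noclaw).
Qed.

Lemma large_third {T : finType} {S L R M : {set T}} : S \subset L :|: R :|: M ->
  exists2 D, D \in [:: L; R; M] & (#|S| <= 3 * #|D|)%N.
Proof.
move=> /subset_leq_card SLRM.
have [LRM _] := leq_card_setU (L :|: R) M; have [LR _] := leq_card_setU L R.
have [?|?] := leqP #|S| (3 * #|L|); first by exists L; rewrite ?inE ?eqxx.
have [?|?] := leqP #|S| (3 * #|R|); first by exists R; rewrite ?inE ?eqxx ?orbT.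
by exists M; [rewrite !inE eqxx !orbT | lia].
Qed.


Theorem theorem4p4 (G : sgraph) (A B S : {set G}) :
  structured_pair (1 / 10 : rat) A B S ->
  ~ contains_induced G claw ->
  ~ contains_induced G C5 ->
  exists (S' : {set G}) (P : {set {set induced S'}}),
    [/\ S' \subset S /\ (#|S|%:R / 5 <= #|S'|%:R :> rat),
        partition P [set: induced S'],
        forall X, X \in P -> exists2 a, a \in A & val @: X \subset nbh a,
        forall X, X \in P -> is_module X
      & exists2 F : sgraph, triangle_free F &
          isomorphic (quotient_graph P) (line_graph F)].
Proof.
move=> sp noclaw noC5.
pose L := [set s in S | ~~ [exists t in S, nested_before A B t s]].
pose R := [set s in S | ~~ [exists t in S, nested_before A B s t]].
have cover : S \subset L :|: R :|: nested_middle A B S.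
  by apply/subsetP => s sS; rewrite !inE sS /=; do 2!case: existsP => _.
have [T TLRM T3] := large_third cover.
have TS : T \subset S.
  by move: TLRM; rewrite !inE => /or3P[]/eqP->; apply/subsetP => s; rewrite inE => /andP[].
exists T.
suff [P [? ? ? ?]] : exists P : {set {set induced T}},
    [/\ partition P [set: induced T],
        forall X, X \in P -> exists2 a, a \in A & val @: X \subset nbh a,
        forall X, X \in P -> is_module X
      & exists2 F : sgraph, triangle_free F &
          isomorphic (quotient_graph P) (line_graph F)].
  exists P; split=> //; split=> //.
  (* A third of |S| is more than the required fifth. *)
  by rewrite -(ler_nat rat) natrM in T3; have : (0 <= #|T|%:R :> rat) by []; lra.
(* A nested pair inside L would put a vertex of S before its second member; inside R, one after its
   first. *)
have [anti|TM] : antichain A B T \/ T = nested_middle A B S.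
  move: TLRM; rewrite !inE => /or3P[]/eqP->; [left|left|by right] => s t;
    rewrite !inE => /andP[sS sn] /andP[tS tn].
    by apply: contraNN tn => l; apply/existsP; exists s; rewrite sS.
  by apply: contraNN sn => l; apply/existsP; exists t; rewrite tS.
- apply: (kernel_decomposition (antichain_adj sp noclaw TS anti)) => s sT.
  (* All vertices of a class share A_s, so any neighbour of s in A serves. *)
  have [a aA sa] := sep_partner sp (subsetP TS _ sT).
  exists a => // t _ fts _.
  have : a \in nbh_in A s by rewrite in_nbh_in sa.
  by rewrite -fts in_nbh_in adj_sym => /andP[].
(* By transitivity, adjacency in T means equal closed neighbourhoods within T, the first label. The
   second label is injective: it adds no adjacency and makes every class a singleton. *)
- apply: (@kernel_decomposition _ _ _ (fun s => cnbh s :&: T) (@set1 G)) => [s t sT tT nst|s sT].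
    rewrite (inj_eq set1_inj) (negPf nst) orbF.
    have trans := nested_middle_trans sp noclaw noC5; rewrite -TM in trans.
    have sub (x y : G) : x \in T -> y \in T -> adj x y ->
        cnbh x :&: T \subset cnbh y :&: T.
      move=> xT yT xy; apply/subsetP => z; rewrite !inE => /andP[+ zT].
      rewrite zT andbT => /predU1P[->|xz]; first by rewrite adj_sym xy orbT.
      have [//|nzy] := eqVneq z y.
      by rewrite (trans _ _ _ yT xT zT) ?orbT // 1?adj_sym // eq_sym.
    apply/idP/eqP => [st|/setP/(_ t)].
      by apply/eqP; rewrite eqEsubset !sub // adj_sym.
    by rewrite !inE tT eqxx andbT eq_sym (negPf nst).
  have [a aA sa] := sep_partner sp (subsetP TS _ sT).
  by exists a => // t _ _ /set1_inj->; rewrite adj_sym.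
Qed.
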